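(* For a Hausdorff space $X$ the following conditions are equivalent: (1) $X$ has countable $\mathrm{sb}$-character; (2) $X$ is an $\alpha_1$-space with countable $\mathrm{cs}^*$-character; (3) $X$ is an $\alpha_4$-space with countable $\mathrm{cs}^*$-character; (4) $\mathrm{cs}^*_\chi(X)\le\aleph_0$ and $\mathrm{sb}_\chi(X)<\mathfrak p$. Moreover, if $X$ is $c$-sequential and each point of $X$ is regular $G_\delta$, then the conditions (1)–(4) are equivalent to: (5) $\mathrm{cs}^*_\chi(X)\le\aleph_0$ and $\mathrm{sb}_\chi(X)<\mathfrak d$.
   Context: A family $\mathcal N$ of subsets of $X$ is a $\mathrm{cs}^*$-network at $x\in X$ if for every neighborhood $U$ of $x$ and every sequence $(x_n)\subset X$ convergent to $x$ there is $N\in\mathcal N$ with $N\subset U$ such that $x_n\in N$ for infinitely many $n$. A set $B\subset X$ is a sequential barrier at $x$ if every sequence in $X$ convergent to $x$ has all but finitely many terms in $B$. An $\mathrm{sb}$-network at $x$ is a family $\mathcal N$ of sequential barriers at $x$ such that for every neighborhood $U$ of $x$ there is $N\in\mathcal N$ with $x\in N\subset U$. $\mathrm{cs}^*_\chi(X)$ (resp. $\mathrm{sb}_\chi(X)$) is the supremum over $x\in X$ of the smallest size of a $\mathrm{cs}^*$-network (resp. $\mathrm{sb}$-network) at $x$. $X$ has countable $\mathrm{cs}^*$-character (resp. $\mathrm{sb}$-character) if $\mathrm{cs}^*_\chi(X)\le\aleph_0$ (resp. $\mathrm{sb}_\chi(X)\le\aleph_0$). In the next definitions, a sequence converging to $x$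 is a countable infinite subset $S\subset X$ such that $S\setminus U$ is finite for each neighborhood $U$ of $x$. $X$ is an $\alpha_1$-space (resp. $\alpha_4$-space) if for any sequences $S_n\subset X$, $n\in\omega$, convergent to a point $x\in X$ there is a sequence $S\subset X$ convergent to $x$ such that $S_n\setminus S$ is finite for all $n$ (resp. $S_n\cap S\ne\emptyset$ for infinitely many $n$). $X$ is $c$-sequential if for each closed subspace $Y\subset X$ and each non-isolated point $y$ of $Y$ there is a sequence $(y_n)\subset Y\setminus\{y\}$ convergent to $y$. A point $x\in X$ is regular $G_\delta$ if $\{x\}=\bigcap\mathcal B$ for some countable family $\mathcal B$ of closed neighborhoods of $x$ in $X$. $\mathfrak p$ is the smallest size of a family $\mathcal F$ of infinite subsets of $\omega$ closed under finite intersections and such that there is no infinite $I\subset\omega$ with $I\setminus F$ finite for every $F\in\mathcal F$. $\mathfrak d$ is the cofinality of $\mathbb N^\omega$ with the coordinatewise order. *)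

(* Defs.v *)
From HB Require Import structures.
From mathcomp Require Import all_boot all_order.
From mathcomp Require Import mathcomp_extra boolp classical_sets functions.
From mathcomp Require Import cardinality filter topology_structure.
From mathcomp Require Import separation_axioms.

Set Implicit Arguments.
Unset Strict Implicit.
Unset Printing Implicit Defensive.

Local Open Scope classical_set_scope.
Local Open Scope card_scope.

(* A cardinal is represented by a set of that cardinality; cardinals are only
   ever compared through the relations #<= and card_lt. *)
Definition card_lt T U (A : set T) (B : set U) : Prop :=
  A #<= B /\ ~ (B #<= A).

(* The least cardinality of a member of the nonempty class C, represented by a
   member of C realizing it (which exists: see min_cardP). *)
Definition min_card T (C : set (set T)) : set T :=
  xget set0 [set A | C A /\ forall B, C B -> A #<= B].

Lemma min_cardP T (C : set (set T)) : C !=set0 ->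
  C (min_card C) /\ forall B, C B -> min_card C #<= B.
Proof.
move=> [C0 CC0].
suff Emin : exists A, C A /\ forall B, C B -> A #<= B by exact: xgetPex Emin.
pose good (G : set (set T -> T)) :=
  (forall f, G f -> forall A, C A -> A (f A)) /\
  (forall f g A, G f -> G g -> C A -> f A = g A -> f = g).
have [G [Ggood Gmax]] : exists G, good G /\ forall H, G `<` H -> ~ good H.
  apply: Zorn_bigcup => F Fgood Ftot; split.
    move=> f [G FG Gf] A CA.
    by have [Gin _] := Fgood _ FG; exact: Gin Gf _ CA.
  move=> f g A [G FG Gf] [H FH Hg].
  have [GH|HG] := Ftot _ _ FG FH.
    by have [_ inj] := Fgood _ FH; apply: inj => //; exact: GH.
  by have [_ inj] := Fgood _ FG; apply: inj => //; exact: HG.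
have [A [CA AG]] : exists A, C A /\ forall a, A a -> exists f, G f /\ f A = a.
  apply: contrapT => noA.
  have fresh A : C A -> exists a, A a /\ forall f, G f -> f A <> a.
    move=> CA; apply: contrapT => no; apply: noA; exists A; split=> // a Aa.
    apply: contrapT => nof; apply: no; exists a; split=> // f Gf fAa.
    by apply: nof; exists f.
  have [t0 _] := fresh _ CC0.
  have /choice[h hP] : forall A, exists a,
      C A -> A a /\ forall f, G f -> f A <> a.
    move=> A; have [/fresh[a aP]|nCA] := pselect (C A); first by exists a.
    by exists t0.
  apply: (Gmax (G `|` [set h])).
    rewrite properEneq; split; last exact: subsetUl.
    apply/eqP => E; have Gh : G h by rewrite E; right.
    by have [_ /(_ _ Gh)] := hP _ CC0.
  split=> [f [Gf|->] B CB|f g B].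
  - by have [Gin _] := Ggood; exact: Gin Gf _ CB.
  - by have [] := hP _ CB.
  - case=> [Gf|->] [Gg|->] CB // fg.
    + by have [_ inj] := Ggood; exact: inj Gf Gg CB fg.
    + by have [_ /(_ _ Gf)] := hP _ CB.
    + by have [_ /(_ _ Gg)] := hP _ CB; rewrite fg.
exists A; split=> // B CB.
have [[t0 _]|noT] := pselect (exists t : T, True); last first.
  suff -> : A = set0 by rewrite card_ge0.
  by apply/seteqP; split=> // t _; case: noT; exists t.
have /choice[F FP] : forall a, exists f, A a -> G f /\ f A = a.
  move=> a; have [/AG[f fP]|nAa] := pselect (A a); first by exists f.
  by exists (fun=> t0).
pose k a := F a B.
have kinj : {in A &, injective k}.
  move=> a b /set_mem Aa /set_mem Ab kab.
  have [GFa <-] := FP _ Aa; have [GFb <-] := FP _ Ab.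
  by have [_ inj] := Ggood; rewrite (inj _ _ _ GFa GFb CB kab).
rewrite -(card_le_eql (inj_card_eq kinj)).
apply: subset_card_le => _ [a Aa <-]; have [GFa _] := FP _ Aa.
by have [Gin _] := Ggood; exact: Gin GFa _ CB.
Qed.

Section network.
Context {X : topologicalType}.
Implicit Types (x : X) (B S : set X) (N : set (set X)).

Definition cs_star_network x N : Prop :=
  forall (U : set X) (u : nat -> X), nbhs x U -> u @ \oo --> x ->
  exists2 A, N A & A `<=` U /\ infinite_set [set n | A (u n)].

Definition sequential_barrier x B : Prop :=
  forall u : nat -> X, u @ \oo --> x -> finite_set [set n | ~ B (u n)].

Definition sb_network x N : Prop :=
  (forall B, N B -> sequential_barrier x B) /\
  forall U : set X, nbhs x U -> exists2 B, N B & B x /\ B `<=` U.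

(* Convergence of a sequence viewed as a countable infinite subset, as used in
   the definitions of alpha1- and alpha4-spaces; S may contain x. *)
Definition set_converges S x : Prop :=
  [/\ countable S, infinite_set S &
      forall U : set X, nbhs x U -> finite_set (S `\` U)].

End network.

Section character.
Variable X : topologicalType.

Definition cs_star_character_at (x : X) : set (set X) :=
  min_card (@cs_star_network X x).

Definition sb_character_at (x : X) : set (set X) :=
  min_card (@sb_network X x).

(* Suprema of cardinals are least upper bounds. All the cardinals involved are
   at most that of the powerset of X, hence so is their supremum: nothing is
   lost by looking for it among the cardinalities of sets of subsets of X. *)
Definition cs_star_character : set (set X) :=
  min_card [set K : set (set X) | forall x, cs_star_character_at x #<= K].

Definition sb_character : set (set X) :=
  min_card [set K : set (set X) | forall x, sb_character_at x #<= K].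

Definition countable_cs_star_character : Prop := countable cs_star_character.

Definition countable_sb_character : Prop := countable sb_character.

Definition alpha1_space : Prop :=
  forall (x : X) (S_ : nat -> set X), (forall n, set_converges (S_ n) x) ->
  exists2 S, set_converges S x & forall n, finite_set (S_ n `\` S).

Definition alpha4_space : Prop :=
  forall (x : X) (S_ : nat -> set X), (forall n, set_converges (S_ n) x) ->
  exists2 S, set_converges S x & infinite_set [set n | S_ n `&` S !=set0].

Definition c_sequential : Prop :=
  forall (Y : set X) (y : X), closed Y -> Y y -> ~ isolated Y y ->
  exists2 u : nat -> X, (forall n, (Y `\ y) (u n)) & u @ \oo --> y.

End character.
Arguments cs_star_character : clear implicits.
Arguments sb_character : clear implicits.

Definition regular_Gdelta {X : topologicalType} (x : X) : Prop :=
  exists B : set (set X), [/\ countable B,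
    forall A, B A -> closed A /\ nbhs x A & [set x] = \bigcap_(A in B) A].

Definition frak_p : set (set nat) :=
  min_card [set F : set (set nat) | [/\ forall A, F A -> infinite_set A,
    setI_closed F & ~ exists2 I : set nat, infinite_set I &
      forall A, F A -> finite_set (I `\` A)]].

Definition frak_d : set (nat -> nat) :=
  min_card [set D : set (nat -> nat) |
    forall f : nat -> nat, exists2 g, D g & forall n, f n <= g n].

(* Main.v *)
(* Call x diagonal if, given sequences s_0, s_1, ... converging to x and
   avoiding x, some sequence converges to x, takes all its terms from the s_k,
   and only finitely many from each s_k. If x is diagonal and N_0, N_1, ... is a
   cs*-network at x, then for every neighborhood U of x one of the sets
   {x} + union of the N_i with i <= k and N_i inside U is a sequential barrier:
   otherwise, for each k a sequence s_k converging to x avoids the k-th such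
   set, and no N_i inside U contains infinitely many terms of a diagonal
   sequence.
   Hence the finite unions of the N_i, with x added, contain a countable
   sb-network.
   Each of alpha_4, sb < p and (for c-sequential X and regular G_delta x) sb < d
   makes x diagonal: for p, a pseudo-intersection of the sets
   {(m, j) | m >= k and s_m(j) in B}, B a finite intersection of barriers, is a
   diagonal sequence; for d, if no diagonal sequence exists then the rates
   at which the s_k enter the barriers of an sb-network form a dominating
   family. *)
Require Import Defs.
From mathcomp Require Import all_boot all_order.
From mathcomp Require Import mathcomp_extra boolp classical_sets functions.
From mathcomp Require Import cardinality filter topology_structure.
From mathcomp Require Import separation_axioms.

Set Implicit Arguments.
Unset Strict Implicit.
Unset Printing Implicit Defensive.

Local Open Scope classical_set_scope.
Local Open Scope card_scope.

(** * Squares of infinite cardinals *)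

(** Gives the injection as a total function that can be composed freely; [u0] settles the case of an
    empty [U]. *)
Lemma card_le_inj T U (A : set T) (B : set U) (u0 : U) : A #<= B ->
  exists f : T -> U, (forall a, A a -> B (f a)) /\ {in A &, injective f}.
Proof.
elim/Ppointed: U => U in B u0 *; first by have := no u0.
by move=> /pcard_leP[f]; exists f; split=> [a Aa|]; [exact: funS|exact: inj].
Qed.

Lemma inj_card_leW T U (A : set T) (B : set U) (f : T -> U) :
  (forall a, A a -> B (f a)) -> {in A &, injective f} -> A #<= B.
Proof.
move=> fAB /inj_card_eq/card_le_eql <-.
by apply: subset_card_le => _ [a /fAB Bfa <-].
Qed.

Lemma infinite_inj T (A : set T) : infinite_set A ->
  exists2 f : nat -> T, forall n, A (f n) & injective f.
Proof.
move=> Ainf; have [t0 _] := infinite_setN0 Ainf.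
have /(card_le_inj t0)[f [fA finj]] := (infiniteP A).1 Ainf.
by exists f => [n|m n]; [exact: fA|apply: finj; rewrite inE].
Qed.

Lemma inj_infinite T (A : set T) (f : nat -> T) :
  (forall n, A (f n)) -> injective f -> infinite_set A.
Proof.
by move=> fA fI; apply/infiniteP/(@inj_card_leW _ _ _ _ f) => // ? ? _ _ /fI.
Qed.

(** The class consisting of [A] and [B] has a member of least cardinality. *)
Lemma card_le_total T (A B : set T) : A #<= B \/ B #<= A.
Proof.
have [|[] -> le_min] := @min_cardP T [set A; B]; first by exists A; left.
  by left; apply: le_min; right.
by right; apply: le_min; left.
Qed.

Section square.
Variables (T : Type) (A : set T).

(* A set of triples (a, b, c) stands for a partial pairing (a, b) |-> c; its
   field is read off the diagonal. *)
Let fld (G : set (T * T * T)) : set T := [set a | exists c, G (a, a, c)].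

(** The graphs to which Zorn's lemma is applied: the square of the field is sent injectively into
    the field. A pair may have several values, one being chosen later. The guard in the last clause
    admits the empty graph, the union of the empty chain. *)
Let pairing (G : set (T * T * T)) :=
  [/\ forall a b c, G (a, b, c) -> [/\ fld G a, fld G b & fld G c],
      forall a b, fld G a -> fld G b -> exists c, G (a, b, c),
      forall a b a' b' c, G (a, b, c) -> G (a', b', c) -> a = a' /\ b = b',
      fld G `<=` A & G !=set0 -> infinite_set (fld G)].

Let pairing_bigcup (F : set (set (T * T * T))) :
  F `<=` pairing -> total_on F subset -> pairing (\bigcup_(G in F) G).
Proof.
move=> Fp Ftot.
have fldU G : F G -> fld G `<=` fld (\bigcup_(G in F) G).
  by move=> FG a [c Gc]; exists c, G.
have common G H : F G -> F H -> exists K, [/\ F K, G `<=` K & H `<=` K].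
  move=> FG FH; have [GH|HG] := Ftot _ _ FG FH; last first.
    by exists G; split.
  by exists H; split.
split.
- move=> a b c [G FG Gabc]; have [G1 _ _ _ _] := Fp _ FG.
  by have [] := G1 _ _ _ Gabc; split; exact: (fldU _ FG).
- move=> a b [c [G FG Ga]] [d [H FH Hb]].
  have [K [FK GK HK]] := common _ _ FG FH.
  have [_ K2 _ _ _] := Fp _ FK.
  have [||e Ke] := K2 a b; [by exists c; exact: GK|by exists d; exact: HK|].
  by exists e, K.
- move=> a b a' b' c [G FG Ga] [H FH Hb].
  have [K [FK GK HK]] := common _ _ FG FH.
  by have [_ _ K3 _ _] := Fp _ FK; apply: K3; [exact: GK Ga|exact: HK Hb].
- by move=> a [c [G FG Ga]]; have [_ _ _ GA _] := Fp _ FG; apply: GA; exists c.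
- move=> [t [G FG Gt]]; have [_ _ _ _ Ginf] := Fp _ FG.
  by apply: sub_infinite_set (fldU _ FG) (Ginf _); exists t.
Qed.

(** The pairing of natural numbers, transported along [i], shows that a maximal graph is
    nonempty. *)
Let pairing_nat (i : nat -> T) : (forall n, A (i n)) -> injective i ->
  exists2 G, pairing G & G !=set0.
Proof.
move=> iA iinj.
pose G := [set t | exists m n, t = (i m, i n, i (pickle (m, n)))].
have fldG n : fld G (i n) by exists (i (pickle (n, n))), n, n.
have fldGP a : fld G a -> exists n, a = i n.
  by move=> [c [m [n [-> _ _]]]]; exists m.
exists G; last by exists (i 0%N, i 0%N, i (pickle (0%N, 0%N))), 0%N, 0%N.
split=> [a b c [m [n [-> -> ->]]]|a b /fldGP[m ->] /fldGP[n ->]| ||_].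
- by split.
- by exists (i (pickle (m, n))), m, n.
- move=> a b a' b' c [m [n [-> -> ->]]] [m' [n' [-> -> /iinj]]].
  by move=> /(pcan_inj pickleK)[-> ->].
- by move=> a /fldGP[n ->]; exact: iA.
- exact: inj_infinite fldG iinj.
Qed.

(* A copy of B, embedded by h in the complement of B, is added to B; r injects
   the enlarged field back in B. *)
Let pairing_extend (G : set (T * T * T)) (p : T -> T -> T) (b0 b1 : T)
    (h k : T -> T) :
    pairing G -> (forall a b, fld G a -> fld G b -> G (a, b, p a b)) ->
    fld G b0 -> fld G b1 -> b0 <> b1 ->
    (forall b, fld G b -> (A `\` fld G) (h b)) ->
    (forall b, fld G b -> k (h b) = b) ->
  exists2 G', pairing G' & G `<` G'.
Proof.
move=> [G1 G2 G3 GA Ginf] pG B0 B1 b01 hA hK.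
pose B := fld G; pose C := h @` B.
have CB c : C c -> ~ B c by move=> [b Bb <-] /=; have [] := hA _ Bb.
have pB a b : B a -> B b -> B (p a b).
  by move=> Ba Bb; have [] := G1 _ _ _ (pG _ _ Ba Bb).
have pinj a b a' b' : B a -> B b -> B a' -> B b' -> p a b = p a' b' ->
    a = a' /\ b = b'.
  move=> Ba Bb Ba' Bb' E; have := pG _ _ Ba Bb; rewrite E => /G3; apply.
  exact: pG.
(* [b0] tags the points of [B] and [b1] those of its copy; since [p] is injective, the tags keep the
   two apart. *)
pose r u := if pselect (B u) then p b0 u else p b1 (k u).
have kC c : C c -> B (k c) by move=> [b Bb <-]; rewrite hK.
have hkC c : C c -> h (k c) = c by move=> [b Bb <-]; rewrite hK.
have rB u : (B `|` C) u -> B (r u).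
  move=> BCu; rewrite /r; case: pselect => [Bu|nBu]; apply: pB => //.
  by case: BCu => // /kC.
have rinj u v : (B `|` C) u -> (B `|` C) v -> r u = r v -> u = v.
  rewrite /r => BCu BCv; case: pselect => Bu; case: pselect => Bv.
  - by move=> /pinj[].
  - by case: BCv => // /kC kv /pinj[].
  - by case: BCu => // /kC ku /pinj[] // E; case: b01.
  - case: BCu => // Cu; case: BCv => // Cv; move=> /pinj[]//; try exact: kC.
    by move=> _ E; rewrite -(hkC _ Cu) E hkC.
have hinj a b : B a -> B b -> h a = h b -> a = b.
  by move=> Ba Bb /(congr1 k); rewrite !hK.
(* Pairs outside the square of [B] get values in the copy [C], so they cannot collide with values of
   [G]. *)
pose New := [set t : T * T * T | [/\ (B `|` C) t.1.1, (B `|` C) t.1.2,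
  ~ (B t.1.1 /\ B t.1.2) & t.2 = h (p (r t.1.1) (r t.1.2))]].
pose G' := G `|` New.
have newC a b c : New (a, b, c) -> C c.
  by move=> [/= BCa BCb _ ->]; apply: imageP; apply: pB; exact: rB.
have fldG' : fld G' = B `|` C.
  apply/seteqP; split=> [a [c [Gc|[]]]//|a [[c Gc]|Ca]].
  - by left; exists c.
  - by exists c; left.
  - exists (h (p (r a) (r a))); right; split=> //=; [by right|by right|].
    by move=> [Ba _]; exact: CB Ba.
exists G'.
  split; rewrite ?fldG'.
  - move=> a b c [/G1[Ba Bb Bc]|N]; first by split; left.
    by have Cc := newC _ _ _ N; case: N => /=; split=> //; right.
  - move=> a b BCa BCb; have [[Ba Bb]|nB] := pselect (B a /\ B b).
      by exists (p a b); left; exact: pG.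
    by exists (h (p (r a) (r b))); right.
  - move=> a b a' b' c [Ga|Na] [Gb|Nb].
    + exact: G3 Ga Gb.
    + by have [_ _ Bc] := G1 _ _ _ Ga; have /CB := newC _ _ _ Nb.
    + by have [_ _ Bc] := G1 _ _ _ Gb; have /CB := newC _ _ _ Na.
    + move: Na Nb => [/= BCa BCb _ ->] [/= BCa' BCb' _].
      move=> /hinj; case/(_ _ _)/pinj => //; try exact: rB.
      * by apply: pB; exact: rB.
      * by apply: pB; exact: rB.
      by move=> /rinj-> // /rinj->.
  - by move=> a [/GA//|[b /hA[Ab _] <-]].
  - move=> _; apply: sub_infinite_set (@subsetUl _ _ _) (Ginf _).
    by exists (b0, b0, p b0 b0); exact: pG.
rewrite properEneq; split; last exact: subsetUl.
apply/eqP => E; have Ch : C (h b0) by exists b0.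
apply: (CB _ Ch); have : fld G' (h b0) by rewrite fldG'; right.
by rewrite -E.
Qed.

(** Take a maximal pairing, with field [B]. If [B] embedded in its complement in [A], the pairing
    could be extended; so the complement embeds in [B]. Tagging the two pieces then injects all of
    [A] into [B], and the pairing of [B] is pulled back along this injection. *)
Lemma infinite_square : infinite_set A -> exists p : T -> T -> T,
  (forall a b, A a -> A b -> A (p a b)) /\
  (forall a b a' b', A a -> A b -> A a' -> A b' ->
     p a b = p a' b' -> a = a' /\ b = b').
Proof.
move=> /infinite_inj[i iA iinj].
have [G [Gp Gmax]] := Zorn_bigcup pairing_bigcup.
have G0 : G !=set0.
  have [H Hp H0] := pairing_nat iA iinj.
  apply: contrapT => nG0; apply: (Gmax _ _ Hp).
  have -> : G = set0 by apply/seteqP; split=> // t Gt; apply: nG0; exists t.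
  rewrite properEneq; split=> //; apply/eqP => E.
  by case: H0 => t; rewrite -E.
have [G1 G2 G3 GA /(_ G0) Binf] := Gp.
pose B := fld G.
have /choice[q qG] : forall ab, exists c, B ab.1 -> B ab.2 -> G (ab, c).
  move=> [a b]; have [[/G2 Ba /Ba[c Gc]]|nB] := pselect (B a /\ B b).
    by exists c.
  by exists a => /= Ba Bb; case: nB.
pose p a b := q (a, b).
have pG a b : B a -> B b -> G (a, b, p a b) by move=> Ba Bb; exact: (qG (a, b)).
have pB a b : B a -> B b -> B (p a b).
  by move=> Ba Bb; have [] := G1 _ _ _ (pG _ _ Ba Bb).
have pinj a b a' b' : B a -> B b -> B a' -> B b' -> p a b = p a' b' ->
    a = a' /\ b = b'.
  move=> Ba Bb Ba' Bb' E; have := pG _ _ Ba Bb; rewrite E => /G3; apply.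
  exact: pG.
have [j jB jinj] := infinite_inj Binf.
have [B0 B1] := (jB 0%N, jB 1%N).
have j01 : j 0%N <> j 1%N by move=> /jinj.
have [AB|BA] := card_le_total (A `\` B) B; last first.
  have [h [hA hinj]] := card_le_inj (j 0%N) BA.
  have /choice[k kP] : forall c, exists b, (h @` B) c -> B b /\ h b = c.
    move=> c; have [[b Bb <-]|nc] := pselect ((h @` B) c); first by exists b.
    by exists c.
  have [||G' G'p GG'] := @pairing_extend G p _ _ h k Gp pG B0 B1 j01.
  - by [].
  - move=> b Bb; have [|Bk hk] := kP (h b); first by exists b.
    by apply: hinj; rewrite ?inE.
  - by case: (Gmax _ GG' G'p).
have [h [hB hinj]] := card_le_inj (j 0%N) AB.
pose r u := if pselect (B u) then p (j 0%N) u else p (j 1%N) (h u).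
have rB u : A u -> B (r u).
  rewrite /r => Au; case: pselect => [Bu|nBu]; apply: pB => //.
  exact: hB.
have rinj u v : A u -> A v -> r u = r v -> u = v.
  rewrite /r => Au Av; case: pselect => Bu; case: pselect => Bv.
  - by move=> /pinj[].
  - by move=> /pinj[]//; exact: hB.
  - by move=> /pinj[]//; [exact: hB|move=> E; case: j01].
  - by move=> /pinj[]//; [exact: hB|exact: hB|move=> _ /hinj->//; rewrite inE].
exists (fun a b => p (r a) (r b)); split=> [a b Aa Ab|a b a' b' Aa Ab Aa' Ab'].
  by apply: GA; apply: pB; exact: rB.
by move=> /pinj[||||/rinj-> // /rinj->//]; exact: rB.
Qed.

End square.

(** Lists are coded by iterating the pairing. Such codes are injective only among lists of equal
    length, so the length is coded too, together with the number [k]. *)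
Lemma card_seq_nat_le (T : eqType) (A : set T) : infinite_set A ->
  [set lk : seq T * nat | [set` lk.1] `<=` A] #<= A.
Proof.
move=> Ainf; have [i iA iinj] := infinite_inj Ainf.
have [p [pA pinj]] := infinite_square Ainf.
pose f l := foldr p (i 0%N) l.
have fA l : [set` l] `<=` A -> A (f l).
  elim: l => [|a l IHl] lA; first exact: iA.
  apply: pA; first by apply: lA; rewrite /= inE eqxx.
  by apply: IHl => b bl; apply: lA; rewrite /= inE bl orbT.
have finj l l' : [set` l] `<=` A -> [set` l'] `<=` A -> size l = size l' ->
    f l = f l' -> l = l'.
  elim: l l' => [|a l IHl] [|a' l']//= lA l'A [sl].
  have lA' : [set` l] `<=` A by move=> b bl; apply: lA; rewrite /= inE bl orbT.
  have l'A' : [set` l'] `<=` A.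
    by move=> b bl; apply: l'A; rewrite /= inE bl orbT.
  move=> /pinj[||||->]; try exact: fA.
  - by apply: lA; rewrite /= inE eqxx.
  - by apply: l'A; rewrite /= inE eqxx.
  - by move=> /IHl->.
pose g (lk : seq T * nat) := p (i (pickle (size lk.1, lk.2))) (f lk.1).
apply: (@inj_card_leW _ _ _ _ g).
  by move=> [l k] /= lA; apply: pA; [exact: iA|exact: fA].
move=> [l k] [l' k']; rewrite !inE /g /= => lA l'A.
move=> /pinj[||||/iinj/(pcan_inj pickleK)[sl ->]]; try exact: iA; try exact: fA.
by move=> /finj->.
Qed.

Lemma countable_seq_nat (T : eqType) (A : set T) : countable A ->
  countable [set lk : seq T * nat | [set` lk.1] `<=` A].
Proof.
move=> /countable_injP[f finj].
apply: (@inj_card_leW _ _ _ _ (fun lk => pickle (map f lk.1, lk.2))) => //.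
move=> [l k] [l' k']; rewrite !inE /= => lA l'A /(pcan_inj pickleK)[E ->].
congr (_, _); elim: l l' lA l'A E => [|a l IHl] [|a' l']//= lA l'A [faa' E].
have -> : a = a'.
  by apply: finj faa'; rewrite inE; [apply: lA|apply: l'A]; rewrite /= inE eqxx.
congr (_ :: _); apply: IHl E => b bl; [apply: lA|apply: l'A];
  by rewrite /= inE bl orbT.
Qed.

(** * The cardinals p and d *)

Lemma countable_enum T (A : set T) : countable A -> A !=set0 ->
  exists e : nat -> T, range e = A.
Proof.
move=> /pfcard_geP[->[]//|/surjfunPex[e ->] _]; by exists e.
Qed.

Lemma countable_card_lt T U (A : set T) (B : set U) :
  countable A -> ~ countable B -> card_lt A B.
Proof.
move=> cA ncB; split; last by move=> /sub_countable/(_ cA).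
apply: card_le_trans cA _; by apply/infiniteP => /finite_set_countable.
Qed.

Lemma finite_setCP (P : set nat) :
  finite_set (~` P) <-> \forall n \near \oo, P n.
Proof.
split=> [/finite_seqP[s sP]|[N _ NP]].
  exists (\max_(i <- s) i).+1 => // n /= ltn; apply: contrapT => nPn.
  have : (n \in s) by have : (~` P) n by []; rewrite sP.
  by move=> /(@leq_bigmax_seq _ _ xpredT id _)-/(_ isT); rewrite leqNgt ltn.
apply: sub_finite_set (finite_II N) => n nPn /=; rewrite ltnNge.
by apply/negP => /NP.
Qed.

Lemma infinite_nat_ge (A : set nat) k : infinite_set A ->
  exists2 n, (k <= n)%N & A n.
Proof.
move=> Ainf; apply: contrapT => noA; apply: Ainf.
apply: sub_finite_set (finite_II k) => n An /=; rewrite ltnNge.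
by apply/negP => kn; apply: noA; exists n.
Qed.

Definition pseudo_intersection (F : set (set nat)) (I : set nat) : Prop :=
  infinite_set I /\ forall A, F A -> finite_set (I `\` A).

(** Enumerate the family and pick from the intersection of its members up to the [k]-th an element
    at least [k]; the picks form an infinite set, almost contained in each member. *)
Lemma countable_pseudo_intersection (F : set (set nat)) :
  countable F -> (forall A, F A -> infinite_set A) -> setI_closed F ->
  exists I, pseudo_intersection F I.
Proof.
move=> cF Finf FI; have [->|/set0P F0] := eqVneq F set0.
  by exists setT; split=> //; exact: infinite_nat.
have [e eF] := countable_enum cF F0.
have Fe n : F (e n) by rewrite -eF; exists n.
pose E := fix E k := if k is k'.+1 then E k' `&` e k else e 0%N.
have FE k : F (E k) by elim: k => [|k IHk] //=; exact: FI.
have Ee k i : (i <= k)%N -> E k `<=` e i.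
  elim: k => [|k IHk]; first by rewrite leqn0 => /eqP->.
  by rewrite leq_eqVlt => /predU1P[->|/IHk Ei] n [] // /Ei.
have /choice[g gP] k : exists n, (k <= n)%N /\ E k n.
  by have [n] := infinite_nat_ge k (Finf _ (FE k)); exists n.
exists (range g); split=> [fin|A].
  have /finite_setCP[N _ NP] : finite_set (~` ~` range g) by rewrite setCK.
  by apply: (NP (g N)); [exact: (gP N).1|exists N].
rewrite -eF => -[k _ <-]; apply: sub_finite_set (finite_image g (finite_II k)).
move=> _ [[n _ <-] nek]; exists n => //=; rewrite ltnNge; apply/negP => kn.
by apply: nek; apply: (Ee n) => //; exact: (gP n).2.
Qed.

(** Shows that the class defining p is nonempty. Take an ultrafilter containing all cofinite sets,
    and split an infinite [I] into its even and odd terms: the odd half or its complement is in the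
    ultrafilter, and each misses infinitely many points of [I]. *)
Lemma ultrafilter_no_pseudo_intersection : exists F : set (set nat),
  [/\ forall A, F A -> infinite_set A, setI_closed F &
      ~ exists2 I : set nat, infinite_set I &
        forall A, F A -> finite_set (I `\` A)].
Proof.
have [G [GU ooG]] := ultraFilterLemma eventually_filter.
exists G; split=> [A GA Afin|A B|[I /infinite_inj[e eI einj] IG]].
- have GnA : G (~` A) by apply/ooG/finite_setCP; rewrite setCK.
  by have [n [An nAn]] := filter_ex (filterI GA GnA).
- exact: filterI.
- have half b : infinite_set (e @` [set n | odd n = b]).
    apply: (@inj_infinite _ _ (fun n => e (b + n.*2)%N)) => [n|m n /einj].
      by exists (b + n.*2)%N => //=; rewrite oddD odd_double addbF oddb.
    by move/addnI/double_inj.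
  have [/IG|/IG] := in_ultra_setVsetC (e @` [set n | odd n = true]) GU.
    apply: sub_infinite_set (half false) => _ [n /= n0 <-]; split=> //.
    by move=> [m /= m1 /einj mn]; rewrite -mn m1 in n0.
  apply: sub_infinite_set (half true) => _ [n n1 <-]; split=> //.
  by apply; exists n.
Qed.

Lemma frak_p_le (F : set (set nat)) : (forall A, F A -> infinite_set A) ->
  setI_closed F -> ~ (exists I, pseudo_intersection F I) -> frak_p #<= F.
Proof.
move=> Finf FI noI.
pose C := [set F : set (set nat) | [/\ forall A, F A -> infinite_set A,
    setI_closed F & ~ exists2 I : set nat, infinite_set I &
      forall A, F A -> finite_set (I `\` A)]].
have CF : C F by split=> // -[I Iinf IF]; apply: noI; exists I.
by have [_] := min_cardP (ex_intro _ _ CF); apply.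
Qed.

Lemma uncountable_frak_p : ~ countable frak_p.
Proof.
have [[pinf pI nop] _] := min_cardP ultrafilter_no_pseudo_intersection.
move=> /countable_pseudo_intersection[//|//|I [Iinf Ip]].
by apply: nop; exists I.
Qed.

Definition dominating (D : set (nat -> nat)) : Prop :=
  forall f : nat -> nat, exists2 g, D g & forall n, (f n <= g n)%N.

Lemma dominating_setT : dominating setT.
Proof. by move=> f; exists f. Qed.

Lemma frak_d_le (D : set (nat -> nat)) : dominating D -> frak_d #<= D.
Proof.
by move=> dD; have [_] := min_cardP (ex_intro _ _ dominating_setT); exact.
Qed.

(** Cantor's diagonal: the [n]-th function of an enumeration fails at [n] to bound the diagonal plus
    one. *)
Lemma uncountable_frak_d : ~ countable frak_d.
Proof.
have [d_dom _] := min_cardP (ex_intro _ _ dominating_setT).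
have d0 : frak_d !=set0 by have [g] := d_dom id; exists g.
move=> /countable_enum/(_ d0)[e eE].
have [g Dg] := d_dom (fun n => (e n n).+1).
have : frak_d g by [].
by rewrite -eE => -[n _ <-] /(_ n); rewrite ltnn.
Qed.

(** * Convergent sequences and networks *)

Lemma finite_fibers_preimage T (v : nat -> T) (F : set T) :
  finite_set F -> (forall y, F y -> finite_set [set n | v n = y]) ->
  finite_set (v @^-1` F).
Proof.
move=> Ffin fib; have -> : v @^-1` F = \bigcup_(y in F) [set n | v n = y].
  apply/seteqP; split=> [n Fvn|n [y Fy /= vny]]; last by rewrite /= vny.
  by exists (v n).
exact: bigcup_finite.
Qed.

Lemma inj_finite_preimage (h : nat -> nat) (F : set nat) : injective h ->
  finite_set F -> finite_set (h @^-1` F).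
Proof. by move=> hinj; apply: finite_preimage => ? ? _ _ /hinj. Qed.

Section sequences.
Variable X : topologicalType.
Implicit Types (x : X) (u v : nat -> X) (S B : set X).

Lemma cvg_seqP u x : (u @ \oo --> x) <->
  forall U, nbhs x U -> finite_set [set n | ~ U (u n)].
Proof.
split=> [ux U /ux Uu|fin U /fin Uu]; first exact/(finite_setCP (u @^-1` U)).
exact/(finite_setCP (u @^-1` U)).
Qed.

Lemma cvg_subseq u x (h : nat -> nat) : injective h ->
  u @ \oo --> x -> u \o h @ \oo --> x.
Proof.
move=> hinj /cvg_seqP ux; apply/cvg_seqP => U /ux.
exact: inj_finite_preimage.
Qed.

(** Passes from convergent sets to sequences: a finite-to-one [v] visits the finite set of points of
    [S] outside [U] only finitely often. *)
Lemma set_converges_seq S x v : set_converges S x -> (forall n, S (v n)) ->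
  (forall y, S y -> finite_set [set n | v n = y]) -> v @ \oo --> x.
Proof.
move=> [_ _ Sx] Sv fib; apply/cvg_seqP => U /Sx SU.
have := finite_fibers_preimage SU (fun y SUy => fib y SUy.1).
by apply: sub_finite_set => n nU; split.
Qed.

(** Otherwise an injective sequence in [S] outside [B] would converge to [x] and never enter the
    barrier. *)
Lemma sequential_barrier_set S x B : set_converges S x ->
  sequential_barrier x B -> finite_set (S `\` B).
Proof.
move=> Sx barB; apply: contrapT => /infinite_inj[e eSB einj].
have /barB : e @ \oo --> x.
  apply: (set_converges_seq Sx) => [n|y _]; first by have [] := eSB n.
  apply: (@sub_finite_set _ _ (e @^-1` [set y])) => //.
  by apply: finite_preimage => // m n _ _ /einj.
have -> : [set n | ~ B (e n)] = setT.
  by apply/seteqP; split=> // n _; have [] := eSB n.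
exact: infinite_nat.
Qed.

Lemma nbhs_sequential_barrier x U : nbhs x U -> sequential_barrier x U.
Proof. by move=> xU u /cvg_seqP; exact. Qed.

Lemma sequential_barrierI x A B : sequential_barrier x A ->
  sequential_barrier x B -> sequential_barrier x (A `&` B).
Proof.
move=> barA barB u ux.
apply: (@sub_finite_set _ _ ([set n | ~ A (u n)] `|` [set n | ~ B (u n)])).
  by move=> n /= /not_andP.
by rewrite finite_setU; split; [exact: barA|exact: barB].
Qed.

Lemma sb_network_nbhs x : sb_network x (nbhs x).
Proof.
split=> [B|U xU]; first exact: nbhs_sequential_barrier.
by exists U => //; split=> //; exact: nbhs_singleton.
Qed.

Lemma sb_cs_star_network x N : sb_network x N -> cs_star_network x N.
Proof.
move=> [barN Nx] U u xU ux; have [B NB [_ BU]] := Nx U xU.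
exists B => //; split=> // fin; apply: infinite_nat.
rewrite -(setUv [set n | B (u n)]) finite_setU; split=> //.
exact: barN NB u ux.
Qed.

Hypothesis T1 : accessible_space X.

Lemma nbhs_finite_setC x (F : set X) : finite_set F -> ~ F x -> nbhs x (~` F).
Proof.
move=> Ffin nFx; apply: open_nbhs_nbhs; split=> //; apply: closed_openC.
exact: (@accessible_finite_set_closed X).1.
Qed.

Lemma cvg_finite u x (F : set X) : u @ \oo --> x -> finite_set F -> ~ F x ->
  finite_set [set n | F (u n)].
Proof.
move=> /cvg_seqP ux Ffin /(nbhs_finite_setC Ffin)/ux.
by apply: sub_finite_set => n /= Fun; apply.
Qed.

Lemma range_converges u x : u @ \oo --> x -> (forall n, u n <> x) ->
  set_converges (range u) x.
Proof.
move=> ux unx; split.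
- exact: card_image_le.
(* A finite range would be a finite set without [x], which [u] must leave, although all its terms
   lie there. *)
- move=> /(cvg_finite ux)/(_ _)/wrap[[n _ /unx]//|fin].
  by apply: infinite_nat; apply: sub_finite_set fin => n _; exists n.
- move=> U /((cvg_seqP u x).1 ux)/(finite_image u); apply: sub_finite_set.
  by move=> _ [[n _ <-] nU]; exists n.
Qed.

End sequences.

(** * Diagonal points *)

(** [c m] selects the sequence and [r m] the term in it; the last clause says that [c] tends to
    infinity. *)
Definition diagonal_at (X : topologicalType) (x : X) : Prop :=
  forall s : nat -> nat -> X,
  (forall k, s k @ \oo --> x) -> (forall k j, s k j <> x) ->
  exists (c r : nat -> nat), (fun m => s (c m) (r m)) @ \oo --> x /\
    forall k, finite_set [set m | (c m <= k)%N].

Section diagonal.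
Variable X : topologicalType.
Implicit Types (x : X).

Lemma diagonal_countable_sb_network x N : diagonal_at x -> countable N ->
  cs_star_network x N -> exists2 M, countable M & sb_network x M.
Proof.
move=> diagx cN Nx.
have N0 : N !=set0.
  by have [|A NA _] := Nx setT (cst x) filterT; [exact: cvg_cst|exists A].
have [e eN] := countable_enum cN N0.
(* Finite unions are indexed by lists of numbers, of which there are countably many. *)
pose W (l : seq nat) := x |` [set y | exists2 i, i \in l & e i y].
exists (range W `&` sequential_barrier x).
  apply: (@sub_countable _ _ _ (range W)).
    by apply: subset_card_le => B [].
  exact: sub_countable (card_image_le W setT) (countableP _).
split=> [B []//|U xU].
pose V k := W [seq i <- iota 0 k.+1 | `[< e i `<=` U >]].
suff [k Vbar] : exists k, sequential_barrier x (V k).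
  exists (V k); first by split=> //; apply: imageP.
  split; first by left.
  move=> y [->|[i]]; first exact: nbhs_singleton.
  by rewrite mem_filter => /andP[/asboolP eU _] /eU.
apply: contrapT => nobar.
(* A sequence with infinitely many terms outside [V k] has a subsequence entirely outside. *)
have /choice[s sP] k : exists s : nat -> X,
    s @ \oo --> x /\ forall j, ~ V k (s j).
  apply: contrapT => nos; apply: nobar; exists k => u ux.
  apply: contrapT => /infinite_inj[h hV hinj]; apply: nos.
  by exists (u \o h); split=> //; exact: cvg_subseq.
have [k|k j sx|c [r [vx cfin]]] := diagx s.
- exact: (sP k).1.
- by apply: (sP k).2; left; exact: sx.
(* Some [e i] inside [U] catches infinitely many diagonal terms; but once [c m] exceeds [i], it is
   part of [V (c m)], which [s (c m)] avoids. *)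
have [A + [AU]] := Nx _ _ xU vx; rewrite -eN => -[i _ eA]; apply.
apply: sub_finite_set (cfin i) => m /= Am; rewrite leqNgt; apply/negP => im.
apply: (sP (c m)).2; right; exists i; last by rewrite eA; exact: Am.
rewrite mem_filter mem_iota /= add0n ltnS (ltnW im) andbT; apply/asboolP.
by rewrite eA.
Qed.

Lemma alpha4_diagonal x : accessible_space X -> alpha4_space X ->
  diagonal_at x.
Proof.
move=> T1 alpha4 s sx snx.
pose e c : nat * nat := odflt (0%N, 0%N) (unpickle c).
pose d c := s (e c).1 (e c).2.
(* Removing the first k points from the k-th sequence makes the family
   point-finite. *)
pose S k := range (s k) `\` d @` `I_k.
have Sk k : set_converges (S k) x.
  have [sc sinf sfin] := range_converges T1 (sx k) (snx k).
  split=> [||U /sfin].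
  - by apply: sub_countable sc; exact: card_le_setD.
  - by apply: infinite_setD => //; exact/finite_image/finite_II.
  - by apply: sub_finite_set => y [[]].
have [Z Zx /infinite_inj[h hZ hinj]] := alpha4 x S Sk.
have /choice[r rP] m : exists r, Z (s (h m) r) /\ S (h m) (s (h m) r).
  by have [y [[[r _ <-] nd] Zy]] := hZ m; exists r; split=> //; split.
exists h, r; split=> [|k]; last exact: inj_finite_preimage (finite_II k.+1).
apply: (set_converges_seq Zx) => [m|y _]; first exact: (rP m).1.
have [[m0 m0y]|noy] := pselect (exists m, s (h m) (r m) = y); last first.
  by apply: sub_finite_set (finite_set0 _) => m my; apply: noy; exists m.
(* The point [y] has index [c0] in the enumeration [d], hence is removed from every [S k] with [k]
   above [c0]; so it is picked only while [h m] is at most [c0]. *)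
have yd : d (pickle (h m0, r m0)) = y by rewrite /d /e pickleK.
set c0 := pickle _ in yd.
apply: sub_finite_set (inj_finite_preimage hinj (finite_II c0.+1)).
move=> m /= my; rewrite ltnS leqNgt; apply/negP => lt.
have [_ [_]] := rP m; apply; rewrite my -yd.
by exists c0.
Qed.

Lemma frak_p_diagonal x N : sb_network x N -> ~ (frak_p #<= N) ->
  diagonal_at x.
Proof.
move=> [barN Nx] pN s sx _.
pose e c : nat * nat := odflt (0%N, 0%N) (unpickle c).
pose D := [set lk : seq (set X) * nat | [set` lk.1] `<=` N].
pose F (lk : seq (set X) * nat) := [set c | (lk.2 <= (e c).1)%N /\
  forall B, B \in lk.1 -> B (s (e c).1 (e c).2)].
have [I [Iinf IF]] : exists I, pseudo_intersection (F @` D) I.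
  (* Otherwise p is at most the size of [D]; but [D] is countable if [N] is, and no larger than [N]
     if not. *)
  apply: contrapT => noI; have pF : frak_p #<= D.
    apply: card_le_trans (card_image_le F D); apply: frak_p_le noI.
      move=> _ [[l k] /= lN <-].
      (* A tail of the single sequence [s k] meets the finitely many barriers, which makes the set
         infinite. *)
      have [j0 _ j0P] : \forall j \near \oo, forall B, B \in l -> B (s k j).
        elim: l lN => [|B l IHl] lN; first by exists 0%N.
        have lN' : [set` l] `<=` N.
          by move=> A Al; apply: lN; rewrite /= inE Al orbT.
        have NB : N B by apply: lN; rewrite /= inE eqxx.
        have /(finite_setCP (fun j => B (s k j))) Bnear := barN _ NB _ (sx k).
        apply: filterS2 Bnear (IHl lN') => j Bj lj A.
        by rewrite inE => /predU1P[->|/lj].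
      apply: (@inj_infinite _ _ (fun j => pickle (k, (j0 + j)%N))) => [j|i j].
        by rewrite /F /= /e pickleK /=; split=> //; apply: j0P; exact: leq_addr.
      by move=> /(pcan_inj pickleK)[] /addnI.
    move=> _ _ [[l k] lN <-] [[l' k'] l'N <-]; exists (l ++ l', maxn k k').
      by move=> B; rewrite /= mem_cat => /orP[/lN|/l'N].
    apply/seteqP; split=> [c [/=]|c [[/= kc lc] [/= k'c l'c]]].
      rewrite geq_max => /andP[kc k'c] lc.
      by split; split=> //= B Bl; apply: lc; rewrite mem_cat Bl ?orbT.
    split=> /= [|B]; first by rewrite geq_max kc.
    by rewrite mem_cat => /orP[/lc|/l'c].
  have [cN|ncN] := pselect (countable N).
    apply: uncountable_frak_p.
    exact: sub_countable pF (countable_seq_nat cN).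
  apply: pN; apply: card_le_trans pF (card_seq_nat_le _).
  by move=> /finite_set_countable.
have [h hI hinj] := infinite_inj Iinf.
exists (fun m => (e (h m)).1), (fun m => (e (h m)).2); split.
  apply/cvg_seqP => U /Nx[B NB [_ BU]].
  (* One-element lists yield convergence; the empty list with bound [k.+1] yields that [c] tends to
     infinity. *)
  have /IF : (F @` D) (F ([:: B], 0%N)).
    by exists ([:: B], 0%N) => // A; rewrite /= inE => /eqP->.
  move/(inj_finite_preimage hinj); apply: sub_finite_set => m nU; split=> //.
  by move=> [_ /(_ B)]; rewrite /= inE eqxx => /(_ isT)/BU.
move=> k; have /IF : (F @` D) (F ([::], k.+1)) by exists ([::], k.+1).
move/(inj_finite_preimage hinj); apply: sub_finite_set => m /= mk; split=> //.
by move=> [/=]; rewrite ltnNge mk.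
Qed.

End diagonal.

Lemma regular_Gdelta_seq (X : topologicalType) (x : X) : regular_Gdelta x ->
  exists b : nat -> set X, (forall n, closed (b n) /\ nbhs x (b n)) /\
    forall y, y <> x -> exists n, ~ b n y.
Proof.
move=> [B [cB Bnbhs xE]]; have [B0|/set0P/(countable_enum cB)[e eB]] :=
    eqVneq B set0.
  (* An empty family intersects to the whole space, so [x] is its only point. *)
  exists (fun=> setT); split=> [n|y yx].
    by split; [exact: closedT|exact: filterT].
  by case: yx; have : [set x] y by rewrite xE B0 bigcap_set0.
exists e; split=> [n|y yx]; first by apply: Bnbhs; rewrite -eB; exists n.
apply: contrapT => noe; apply: yx; have : (\bigcap_(A in B) A) y.
  by rewrite -eB => _ [n _ <-]; apply: contrapT => ney; apply: noe; exists n.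
by rewrite -xE.
Qed.

(* If no diagonal sequence converges to x then every f yields a neighborhood of
   x missing the points s' k (f k); the barriers thus dominate every f. *)
Lemma frak_d_diagonal (X : topologicalType) (x : X) N : accessible_space X ->
  c_sequential X -> regular_Gdelta x -> sb_network x N -> ~ (frak_d #<= N) ->
  diagonal_at x.
Proof.
move=> T1 cseq /regular_Gdelta_seq[b [bP bx]] [barN Nx] dN s sx snx.
(* [N0 k] cuts off an initial piece of [s k], so that [s' k] lies in [b 0], ..., [b k]. *)
have /choice[N0 N0P] k :
    exists n0, forall j i, (i <= k)%N -> b i (s k (n0 + j)%N).
  have near_b i : \forall j \near \oo, b i (s k j).
    by apply: sx; exact: (bP i).2.
  have near_le l : \forall j \near \oo, forall i, (i <= l)%N -> b i (s k j).
    elim: l => [|l IHl].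
      by apply: filterS (near_b 0%N) => j bj i; rewrite leqn0 => /eqP->.
    apply: filterS2 (near_b l.+1) IHl => j bj IHj i.
    by rewrite leq_eqVlt => /predU1P[->|/IHj].
  by have [n0 _ n0P] := near_le k; exists n0 => j; apply: n0P; exact: leq_addr.
pose s' k j := s k (N0 k + j)%N.
pose Tn (f : nat -> nat) k :=
  [set s' p.1 p.2 | p in [set p | (p.1 <= k)%N /\ (p.2 <= f p.1)%N]].
pose T f := \bigcup_k Tn f k.
have Tn_fin f k : finite_set (Tn f k).
  apply: finite_image.
  apply: (@sub_finite_set _ _
    (\bigcup_(i in `I_k.+1) ([set i] `*` `I_(f i).+1))).
    by move=> [i j] [/= ik jf]; exists i.
  apply: bigcup_finite => [|i _]; first exact: finite_II.
  by apply: finite_setX; [exact: finite_set1|exact: finite_II].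
have nTnx f k : ~ Tn f k x by move=> [p _ px]; exact: snx px.
(* Away from [x] the set [T f] is closed: the complement of some [b n] is a neighborhood of [y]
   missing all [s' i] with [i] at least [n], and what remains of [T f] is finite. *)
have clT f y : closure (T f) y -> y <> x -> T f y.
  move=> Ty /bx[n nby]; apply: contrapT => nTy.
  have nTny : ~ Tn f n y by move=> Tny; apply: nTy; exists n.
  have nb : nbhs y (~` b n).
    by apply: open_nbhs_nbhs; split=> //; apply: closed_openC; exact: (bP n).1.
  have [z [[k _ [[i j] /= [ik jf] <-]] [nTz nbz]]] :=
    Ty _ (filterI (nbhs_finite_setC T1 (Tn_fin f n) nTny) nb).
  have [ni|ni] := leqP n i; first by apply: nbz; exact: N0P.
  by apply: nTz; exists (i, j) => //; split=> //; exact: ltnW.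
(* If [x] is in the closure of some [T f], c-sequentiality gives a sequence in [T f] converging to
   [x]; it is diagonal, as it leaves each finite set [Tn f k]. *)
have [[f fx]|noT] := pselect (exists f, closure (T f) x).
  have niso : ~ isolated (closure (T f)) x.
    move=> [_ [V xV VT]]; have [z [Tz Vz]] := fx V xV.
    have : (V `&` closure (T f)) z by split=> //; exact: subset_closure.
    by rewrite VT => zx; move: Tz; rewrite zx => -[k _ /nTnx].
  have [u uT ux] := cseq _ _ (@closed_closure _ _) fx niso.
  have /choice[p pP] m :
      exists p : nat * nat, (p.2 <= f p.1)%N /\ s' p.1 p.2 = u m.
    have [Tu unx] := uT m; have [k _ [p [_ pf] pu]] := clT f _ Tu unx.
    by exists p.
  exists (fun m => (p m).1), (fun m => N0 (p m).1 + (p m).2)%N; split=> [|k].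
    suff -> : (fun m => s (p m).1 (N0 (p m).1 + (p m).2)%N) = u by [].
    by apply/funext => m; exact: (pP m).2.
  apply: sub_finite_set (cvg_finite T1 ux (Tn_fin f k) (nTnx f k)) => m /= mk.
  by exists (p m); [split=> //; exact: (pP m).1|exact: (pP m).2].
case: dN.
(* [g B k] is an index from which on [s' k] stays in the barrier [B]; outside [N] the value [id] is
   arbitrary. *)
have /choice[g gP] B : exists gB : nat -> nat, N B ->
    forall k j, (gB k <= j)%N -> B (s' k j).
  have [NB|nNB] := pselect (N B); last by exists id.
  suff /choice[gB gBP] : forall k, exists n, forall j, (n <= j)%N -> B (s' k j).
    by exists gB.
  move=> k; have /(finite_setCP (fun j => B (s k j)))[n _ nB] :=
    barN _ NB _ (sx k).
  by exists n => j nj; apply: nB; apply: leq_trans nj (leq_addl _ _).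
apply: card_le_trans (frak_d_le _) (card_image_le g N) => f.
have [U [xU UT]] : exists U, nbhs x U /\ U `&` T f = set0.
  apply: contrapT => noU; apply: noT; exists f => U xU; apply/set0P/eqP => UT.
  by apply: noU; exists U; rewrite setIC.
have [B NB [_ BU]] := Nx _ xU; exists (g B); first by exists B.
move=> k; rewrite leqNgt; apply/negP => lt.
have : (U `&` T f) (s' k (f k)).
  split; first by apply: BU; apply: gP (ltnW lt).
  by exists k => //; exists (k, f k).
by rewrite UT.
Qed.

(** * Countable sb-networks and the properties alpha_1 and alpha_4 *)

(** Intersect the barriers into a decreasing sequence [D n] and keep from each [S n] its part in
    [D n], losing finitely many points. A neighborhood contains some [D k], so only the sets with
    [n < k] can leave it, each in finitely many points. *)
Lemma countable_sb_alpha1 (X : topologicalType) :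
  (forall x : X, exists2 M, countable M & sb_network x M) -> alpha1_space X.
Proof.
move=> sbX x S Sx; have [M cM [barM Mx]] := sbX x.
have M0 : M !=set0 by have [B] := Mx setT filterT; exists B.
have [e eM] := countable_enum cM M0.
have bar n : sequential_barrier x (e n) by apply: barM; rewrite -eM; exists n.
pose D := fix D n := if n is n'.+1 then D n' `&` e n else e 0%N.
have barD n : sequential_barrier x (D n).
  by elim: n => [|n IHn] //=; exact: sequential_barrierI.
have De n i : (i <= n)%N -> D n `<=` e i.
  elim: n => [|n IHn]; first by rewrite leqn0 => /eqP->.
  by rewrite leq_eqVlt => /predU1P[->|/IHn Di] y [] // /Di.
have SD n := sequential_barrier_set (Sx n) (barD n).
exists (\bigcup_n (S n `&` D n)) => [|n]; last first.
  apply: sub_finite_set (SD n) => y [Sy nDy]; split=> // Dy.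
  by apply: nDy; exists n.
split=> [||U xU].
- apply: bigcup_countable => // n _; have [cS _ _] := Sx n.
  by apply: sub_countable cS; apply: subset_card_le => y [].
- have [_ Sinf _] := Sx 0%N.
  apply: sub_infinite_set (infinite_setD Sinf (SD 0%N)).
  move=> y [Sy nSD]; exists 0%N => //; split=> //.
  by apply: contrapT => nDy; exact: nSD.
- have [B + [_ BU]] := Mx U xU; rewrite -eM => -[k _ ek].
  apply: (@sub_finite_set _ _ (\bigcup_(n in `I_k) (S n `\` U))).
    move=> y [[n _ [Sy Dy]] nUy]; exists n => //=; rewrite ltnNge.
    apply/negP => kn; apply: nUy; apply: BU; rewrite -ek; exact: De kn _ Dy.
  apply: bigcup_finite => [|n _]; first exact: finite_II.
  by have [_ _] := Sx n; exact.
Qed.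

Lemma alpha1_alpha4 (X : topologicalType) : alpha1_space X -> alpha4_space X.
Proof.
move=> alpha1 x S Sx; have [Z Zx SZ] := alpha1 x S Sx; exists Z => //.
suff -> : [set n | S n `&` Z !=set0] = setT by exact: infinite_nat.
apply/seteqP; split=> // n _; have [_ Sinf _] := Sx n.
have [y [Sy nSZ]] := infinite_setN0 (infinite_setD Sinf (SZ n)).
by exists y; split=> //; apply: contrapT => nZy; exact: nSZ.
Qed.

(** * Suprema of cardinals *)

Section characters.
Variables (T I : Type) (c : I -> set T).

Lemma le_sup_card i :
  c i #<= min_card [set K : set T | forall i, c i #<= K].
Proof.
have [|+ _] := @min_cardP T [set K : set T | forall i, c i #<= K]; last exact.
by exists setT => j; exact: card_leT.
Qed.

(** A countable upper bound must be found among the subsets of [T]: all of [T] if it is finite, a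
    countably infinite subset otherwise. *)
Lemma countable_sup_card :
  countable (min_card [set K : set T | forall i, c i #<= K]) <->
  forall i, countable (c i).
Proof.
split=> [csup i|cc]; first exact: sub_countable (le_sup_card i) csup.
suff [K cK Kc] : exists2 K : set T, countable K & forall i, c i #<= K.
  have [_ supK] := @min_cardP T [set K | forall i, c i #<= K] (ex_intro _ K Kc).
  exact: sub_countable (supK _ Kc) cK.
have [Tfin|/infinite_inj[e _ einj]] := pselect (finite_set [set: T]).
  by exists setT => [|i]; [exact: finite_set_countable|exact: card_leT].
exists (range e); first exact: card_image_le.
move=> i; apply: card_le_trans (cc i) _.
by apply/infiniteP; apply: inj_infinite einj.
Qed.

End characters.

(** * Characters of a space and the implications between the conditions *)

Section space.
Variable X : topologicalType.
Implicit Type x : X.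

Lemma cs_star_character_atP x :
  cs_star_network x (cs_star_character_at x) /\
  forall N, cs_star_network x N -> cs_star_character_at x #<= N.
Proof.
apply: (@min_cardP _ (@cs_star_network X x)); exists (nbhs x).
exact/sb_cs_star_network/sb_network_nbhs.
Qed.

Lemma sb_character_atP x :
  sb_network x (sb_character_at x) /\
  forall N, sb_network x N -> sb_character_at x #<= N.
Proof.
apply: (@min_cardP _ (@sb_network X x)); exists (nbhs x).
exact: sb_network_nbhs.
Qed.

Lemma countable_sb_characterP : countable_sb_character X <->
  forall x, exists2 M, countable M & sb_network x M.
Proof.
rewrite /countable_sb_character countable_sup_card.
split=> sbX x; have [netx minx] := sb_character_atP x.
  by exists (sb_character_at x).
by have [M cM /minx/sub_countable] := sbX x; exact.
Qed.

Lemma countable_cs_star_characterP : countable_cs_star_character X <->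
  forall x, exists2 M, countable M & cs_star_network x M.
Proof.
rewrite /countable_cs_star_character countable_sup_card.
split=> csX x; have [netx minx] := cs_star_character_atP x.
  by exists (cs_star_character_at x).
by have [M cM /minx/sub_countable] := csX x; exact.
Qed.

Lemma countable_sb_cs_star : countable_sb_character X ->
  countable_cs_star_character X.
Proof.
move=> /countable_sb_characterP sbX; apply/countable_cs_star_characterP => x.
by have [M cM /sb_cs_star_network] := sbX x; exists M.
Qed.

Lemma diagonal_countable_sb : (forall x, diagonal_at x) ->
  countable_cs_star_character X -> countable_sb_character X.
Proof.
move=> diagX /countable_cs_star_characterP csX; apply/countable_sb_characterP.
by move=> x; have [N cN] := csX x; exact: diagonal_countable_sb_network.
Qed.

Lemma not_le_sb_character_at T (K : set T) x :
  card_lt (sb_character X) K -> ~ (K #<= sb_character_at x).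
Proof.
move=> [_ nK] Kx; apply: nK; apply: card_le_trans Kx _.
exact: (le_sup_card (@sb_character_at X)).
Qed.

(** Used with [K] equal to p and to d, both uncountable. *)
Lemma countable_sb_lt T (K : set T) : ~ countable K ->
  countable_sb_character X ->
  countable_cs_star_character X /\ card_lt (sb_character X) K.
Proof.
move=> ncK sbX; split; first exact: countable_sb_cs_star.
exact: countable_card_lt.
Qed.

Lemma countable_sb_alpha1_cs_star : countable_sb_character X ->
  alpha1_space X /\ countable_cs_star_character X.
Proof.
move=> sbX; split; last exact: countable_sb_cs_star.
exact/countable_sb_alpha1/countable_sb_characterP.
Qed.

Lemma alpha4_cs_star_countable_sb : accessible_space X ->
  alpha4_space X /\ countable_cs_star_character X -> countable_sb_character X.
Proof.
move=> T1 [alpha4]; apply: diagonal_countable_sb => x; exact: alpha4_diagonal.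
Qed.

Lemma lt_frak_p_countable_sb :
  countable_cs_star_character X /\ card_lt (sb_character X) frak_p ->
  countable_sb_character X.
Proof.
move=> [csX sbp]; apply: diagonal_countable_sb csX => x.
apply: (frak_p_diagonal (sb_character_atP x).1).
exact: not_le_sb_character_at sbp.
Qed.

Lemma lt_frak_d_countable_sb : accessible_space X -> c_sequential X ->
  (forall x, regular_Gdelta x) ->
  countable_cs_star_character X /\ card_lt (sb_character X) frak_d ->
  countable_sb_character X.
Proof.
move=> T1 cseq Gd [csX sbd]; apply: diagonal_countable_sb csX => x.
apply: (frak_d_diagonal T1 cseq (Gd x) (sb_character_atP x).1).
exact: not_le_sb_character_at sbd.
Qed.

End space.

Theorem proposition5 (X : topologicalType) (hX : hausdorff_space X) :
  [<-> countable_sb_character X;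
       alpha1_space X /\ countable_cs_star_character X;
       alpha4_space X /\ countable_cs_star_character X;
       countable_cs_star_character X /\ card_lt (sb_character X) frak_p] /\
  (c_sequential X -> (forall x : X, regular_Gdelta x) ->
   [<-> countable_sb_character X;
        alpha1_space X /\ countable_cs_star_character X;
        alpha4_space X /\ countable_cs_star_character X;
        countable_cs_star_character X /\ card_lt (sb_character X) frak_p;
        countable_cs_star_character X /\ card_lt (sb_character X) frak_d]).
Proof.
have T1 := hausdorff_accessible hX.
have alpha14 : alpha1_space X /\ countable_cs_star_character X ->
    alpha4_space X /\ countable_cs_star_character X.
  by move=> [/alpha1_alpha4 alpha4].
have alpha4_p : alpha4_space X /\ countable_cs_star_character X ->
    countable_cs_star_character X /\ card_lt (sb_character X) frak_p.
  move=> /(alpha4_cs_star_countable_sb T1).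
  exact: countable_sb_lt uncountable_frak_p.
split=> [|cseq Gd]; tfae.
- exact: countable_sb_alpha1_cs_star.
- exact: alpha14.
- exact: alpha4_p.
- exact: lt_frak_p_countable_sb.
- exact: countable_sb_alpha1_cs_star.
- exact: alpha14.
- exact: alpha4_p.
(* The bound by d is reached through countable sb-character rather than by comparing p with d. *)
- by move=> /lt_frak_p_countable_sb; exact: countable_sb_lt uncountable_frak_d.
- exact: lt_frak_d_countable_sb.
Qed.
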